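(* For $t\ge0$ let $\mathbf{T}(2,2t+1)$ denote the (positive) $(2,2t+1)$-torus knot, and let $$d_t=T^{2t}\Big(T^{2}\rho_1(\mathbf{T}(2,2t+3))-\rho_1(\mathbf{T}(2,2t+1))\Big)\in\mathbb{Z}[T,T^{-1}].$$ Then the sequence $\{d_t\}_{t\ge 0}$ stabilizes positively and $$\lim_{t\to\infty}d_t=-\frac{1}{(1+T)^2}.$$
   Context: The knots $\mathbf{T}(2,2t+1)$ form a family of knots twisted on $n=2$ coherently oriented strands: $\mathbf{T}(2,2t+1)$ is obtained from the unknot $\mathbf{T}(2,1)$ by inserting $t$ positive full twists (equivalently it is the closure of the 2-braid $\sigma_1^{2t+1}$ with all crossings positive). **The invariant $\rho_1$.** Represent a knot $K$ by an upright long knot diagram $D$: an oriented immersed arc in the unit square with over/under information at transverse double points (crossings), entering at the bottom and leaving at the top, directed upward near its endpoints and such that near each crossing both intersecting pieces are directed upward. Let $\mathcal{C}$ be the set of crossings, $N=|\mathcal{C}|$. The strands are the components of $D-\mathcal{C}$, labeled consecutively $1,\dots,2N+1$ along the orientation. Let $\varphi_k\in\mathbb{Z}$ be the turning number of strand $k$ (full counterclockwise turns minus full clockwise turns). Write a crossing $c$ as a triple $(\sigma,i,j)$: $\sigma=\pm1$ its sign, $i$ its incoming over-strand, $j$ its incoming under-strand; let $i^+=i+1$, $j^+=j+1$ be the outgoing over- and under-strands. Let $A$ be the $(2N+1)\times(2N+1)$ matrix over $\mathbb{Z}[T,T^{-1}]$ which is the sum over crossings $(\sigma,i,j)$ of the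 matrices whose only nonzero entries are $a_{i,i^+}=T^{\sigma}$, $a_{i,j^+}=1-T^{\sigma}$, $a_{j,j^+}=1$. Then $I-A$ is invertible over $\mathbb{Z}(T)$ (the field of rational functions); let $G=(g_{k\ell})=(I-A)^{-1}$. For $c=(\sigma,i,j)$ put $$R_1(c)=\sigma\big(g_{ji}(g_{j^+,j}+g_{j,j^+}-g_{ij})-g_{ii}(g_{j,j^+}-1)-\tfrac12\big).$$ With $\Delta_K$ the symmetrized Alexander polynomial, the perturbed Alexander invariant is $$\rho_1(K)=\Delta_K^2\Big(\sum_{c\in\mathcal{C}}R_1(c)-\sum_{k=1}^{2N+1}\varphi_k(g_{kk}-\tfrac12)\Big)\in\mathbb{Z}[T,T^{-1}],$$ which is a knot invariant. **Convergence.** For $p\in\mathbb{Z}[T,T^{-1}]$ let $(p)_r$ be the coefficient of $T^r$. A sequence $\{p_t\}$ in $\mathbb{Z}[T,T^{-1}]$ stabilizes positively if for every $r_0\in\mathbb{Z}$ there is $t_0$ such that $(p_t)_r=(p_{t_0})_r$ for all $t\ge t_0$ and all $r\le r_0$; its limit is the resulting formal Laurent series in $T$. A rational function is identified with its Laurent expansion at $T=0$. *)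

(* Defs.v *)
From mathcomp Require Import all_boot all_order all_algebra.
From mathcomp Require Import finmap zify.
From mathcomp Require Import boolp classical_sets.

Set Implicit Arguments.
Unset Strict Implicit.
Unset Printing Implicit Defensive.

Import Order.TTheory GRing.Theory Num.Theory.
Local Open Scope ring_scope.

(* The field Z(T), as the field of fractions of Z[T]. *)
Notation ratfun := {fraction {poly int}}.
Definition T : ratfun := tofrac 'X.

(* Laurent polynomials in Z[T, T^-1], as finitely supported coefficient
   functions: [p r] is the coefficient (p)_r of T^r. *)
Notation lpoly := {fsfun int -> int with 0%R}.

Definition lfrac (p : lpoly) : ratfun :=
  \sum_(r <- finsupp p) (p r)%:~R * T ^ r.

Definition stabilizes_positively (p : nat -> lpoly) : Prop :=
  forall r0 : int, exists t0 : nat,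
    forall t : nat, (t0 <= t)%N -> forall r : int, r <= r0 -> p t r = p t0 r.

Definition limit_series (p : nat -> lpoly) (c : int -> int) : Prop :=
  forall r : int, exists t0 : nat, forall t : nat, (t0 <= t)%N -> p t r = c r.

(* The formal series \sum_r c_r T^r, with finitely many nonzero negative terms,
   is the Laurent expansion of f at T = 0: writing f = a / b with a, b in Z[T],
   the product of b and the series is a. *)
Definition laurent_expansion (f : ratfun) (c : int -> int) : Prop :=
  (exists m : int, forall r : int, r < m -> c r = 0) /\
  exists a b : {poly int},
    [/\ b != 0, f = tofrac a / tofrac b
      & forall r : int,
          \sum_(i < size b) b`_i * c (r - i%:Z) =
          (if r is Posz n then a`_n else 0)].

(* A crossing (sigma, i, j): sign, incoming over-strand, incoming
   under-strand. *)
Record crossing := Crossing { sgn : int; over : nat; under : nat }.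

(* The combinatorial data of an upright long knot diagram with N crossings.
   Strands carry the labels 1, ..., 2N+1; each of 1, ..., 2N is the incoming
   over- or under-strand of exactly one crossing, where it is followed by the
   next label. Only the values of [turning] on 1, ..., 2N+1 are meaningful. *)
Record diagram := Diagram {
  crossings : seq crossing;
  turning : nat -> int;
  _ : all (fun c => (sgn c == 1) || (sgn c == -1)) crossings;
  _ : perm_eq (flatten [seq [:: over c; under c] | c <- crossings])
              (iota 1 (size crossings).*2)
}.

Section Invariants.
Variable D : diagram.

Let N := size (crossings D).

(* Matrix index of the strand with label k, for 1 <= k <= 2N+1. *)
Definition strand (k : nat) : 'I_(N.*2.+1) := inord k.-1.

Definition transition_mx : 'M[ratfun]_(N.*2.+1) :=
  \sum_(c <- crossings D)
    (T ^ sgn c *: delta_mx (strand (over c)) (strand (over c).+1)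
     + (1 - T ^ sgn c) *: delta_mx (strand (over c)) (strand (under c).+1)
     + delta_mx (strand (under c)) (strand (under c).+1)).

(* 1 - A is unitriangular at T = 1, so it is invertible over Z(T) and [invmx]
   is its inverse. *)
Definition green_mx : 'M[ratfun]_(N.*2.+1) := invmx (1%:M - transition_mx).

Definition green (k l : nat) : ratfun := green_mx (strand k) (strand l).

Definition R1 (c : crossing) : ratfun :=
  let i := over c in let j := under c in
  (sgn c)%:~R *
    (green j i * (green j.+1 j + green j j.+1 - green i j)
     - green i i * (green j j.+1 - 1) - 2^-1).

(* Alexander matrix of the long Wirtinger presentation, by Fox calculus. There
   is one generator x_k per strand; the k-th relation expresses x_(k+1):
     x_(i+1) = x_i                        if k = i is an over-strand,
     x_(j+1) = x_i^sigma x_j x_i^-sigma   if k = j passes under i.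
   The opposite convention for conjugation exchanges T and T^-1, which does not
   change the symmetrized polynomial. *)
Definition alexander_mx : 'M[ratfun]_(N.*2, N.*2.+1) :=
  let x k : 'rV[ratfun]_(N.*2.+1) := delta_mx 0 (strand k) in
  \matrix_(k < N.*2)
    \sum_(c <- crossings D)
      (if k.+1 == over c then x (over c).+1 - x (over c)
       else if k.+1 == under c then
         x (under c).+1
         - (T ^ sgn c *: x (under c) + (1 - T ^ sgn c) *: x (over c))
       else 0).

(* The Alexander polynomial is the determinant of the Alexander matrix with one
   column deleted, up to a unit +-T^k; the symmetrized one is the multiple which
   is invariant under T <-> T^-1 and takes the value 1 at T = 1. *)
Definition is_alexander (p : lpoly) : Prop :=
  [/\ exists (s : bool) (k : int),
        lfrac p = (-1) ^+ s * T ^ k * \det (col' ord0 alexander_mx),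
      forall r : int, p (- r) = p r
    & \sum_(r <- finsupp p) p r = 1].

Definition alexander : lpoly := xget ([fsfun] : lpoly) is_alexander.

(* The value on a diagram of a knot K is rho_1(K): it does not depend on the
   choice of the diagram. *)
Definition rho1 : ratfun :=
  lfrac alexander ^+ 2 *
    (\sum_(c <- crossings D) R1 c
     - \sum_(1 <= k < N.*2.+2) (turning D k)%:~R * (green k k - 2^-1)).

End Invariants.

(* D is the upright long knot diagram of the closure of a braid word w on n
   strands drawn upward at positions 0, ..., n-1 (left to right). The letter
   (p, 1) crosses positions p and p+1 positively, the strand coming from p being
   over; (p, -1) is its inverse. The long knot enters and leaves at position 0,
   the leftmost one; the other positions are closed by arcs around the right of
   the braid, from top to bottom, each making one clockwise turn. [lab h p] is
   the label of the strand at position p below the h-th letter of w. *)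
Definition long_braid_closure (n : nat) (w : seq (nat * int)) (D : diagram) :
    Prop :=
  exists lab : nat -> nat -> nat,
  [/\ size (crossings D) = size w,
      lab 0%N 0%N = 1%N /\ lab (size w) 0%N = (size w).*2.+1,
      forall p, (0 < p < n)%N -> lab (size w) p = lab 0%N p,
      forall h, (h < size w)%N ->
        let: (p, e) := nth (0%N, 0) w h in
        let l := lab h p in let r := lab h p.+1 in
        [/\ (p.+1 < n)%N,
            lab h.+1 p.+1 = l.+1 /\ lab h.+1 p = r.+1,
            forall q, (q < n)%N -> q != p -> q != p.+1 ->
              lab h.+1 q = lab h q
          & nth (Crossing 0 0 0) (crossings D) h =
              if e == 1 then Crossing e l r else Crossing e r l]
    & forall k, turning D k = - (count (fun p => lab 0%N p == k) (iota 1 n.-1))%:Z].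

(* The positive torus knot T(2, 2t+1), as the long closure of sigma_1^(2t+1)
   (see [torus_diagram_closure]). The crossings, from bottom to top, are met
   with incoming labels 1, ..., 2t+1 on the first passage through the braid and
   2t+2, ..., 4t+2 on the second; strand 2t+2 is the closing arc. *)
Definition torus_crossings (t : nat) : seq crossing :=
  mkseq (fun h => if odd h then Crossing 1 (t.*2.+2 + h) h.+1
                  else Crossing 1 h.+1 (t.*2.+2 + h)) t.*2.+1.

Lemma torus_signs t :
  all (fun c => (sgn c == 1) || (sgn c == -1)) (torus_crossings t).
Proof. by rewrite all_map; apply/allP => h _ /=; case: ifP. Qed.

Lemma torus_labels t :
  perm_eq (flatten [seq [:: over c; under c] | c <- torus_crossings t])
          (iota 1 (size (torus_crossings t)).*2).
Proof.
rewrite size_mkseq -addnn iotaD add1n.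
rewrite /torus_crossings /mkseq; move: (t.*2.+2) => M; move: (t.*2.+1) => n.
suff H a : perm_eq
    (flatten [seq [:: over c; under c] | c <- [seq
       (if odd h then Crossing 1 (M + h) h.+1 else Crossing 1 h.+1 (M + h))
       | h <- iota a n]])
    (iota a.+1 n ++ iota (M + a) n).
  by have := H 0%N; rewrite addn0.
elim: n a => [//|n IH] a; apply/permP => P; have /permP/(_ P) := IH a.+1.
rewrite addnS /= !count_cat /= => {}IH.
by case: (odd a) => /=; rewrite IH; lia.
Qed.

Definition torus_diagram (t : nat) : diagram :=
  @Diagram (torus_crossings t) (fun k => if k == t.*2.+2 then -1 else 0)
    (torus_signs t) (torus_labels t).

Lemma torus_diagram_closure t :
  long_braid_closure 2 (nseq t.*2.+1 (0%N, 1)) (torus_diagram t).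
Proof.
exists (fun h p => if odd h == (p == 1%N) then h.+1 else (t.*2.+2 + h)%N).
rewrite size_nseq; split.
- by rewrite size_mkseq.
- by rewrite /= odd_double /=; split=> //; lia.
- by move=> [|[|p]] //= _; rewrite ?odd_double /= ?addn0.
- move=> h hlt; rewrite nth_nseq hlt; split=> [//|||].
  + by rewrite oddS addnS; case: (odd h).
  + by move=> [|[|q]].
  by rewrite nth_mkseq // eqxx; case: (odd h).
by move=> k; rewrite /= !addn0 eq_sym; case: eqP.
Qed.

(* Main.v *)
From HB Require Import structures.
From mathcomp Require Import all_boot all_order all_algebra.
From mathcomp Require Import fingroup perm.
From mathcomp Require Import finmap.
From mathcomp Require Import zify ring.
From mathcomp Require classical_sets.
Require Import Defs.

Set Implicit Arguments.
Unset Strict Implicit.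
Unset Printing Implicit Defensive.

Import Order.TTheory GRing.Theory Num.Theory.
Local Open Scope ring_scope.

(** Put n = 2t+1 and q = - T.  Write x_h and y_h for the number of visits of
    the random walk with transition matrix A to a fixed strand, when it starts
    on the over-, respectively under-strand entering the h-th crossing from the
    bottom.  A crossing sends (x, y) to (y, x) up to the mixing coefficients,
    so that away from the source x - y is multiplied by a power of q and
    x + T y is constant: these two quantities diagonalise the transfer matrix
    of one crossing.  Closing the braid identifies the under-strand at level n
    with the one at level 0, which fixes the remaining constant.  The Green
    function is therefore explicit ([visits], [green_torus]).

    With e = q^h and f = q^(n-h), the contribution of the h-th crossing
    collapses to
      R_1 = (f - q) (f - e) / (1 - q^n)^2 - 1/2        ([torus_R1]),
    and the closing arc, the only strand which turns, contributes
    (1 - q) / (1 - q^n) - 1/2.  Since Delta^2 = T^(-2t) ((1 - q^n) / (1 - q))^2,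
    summing geometric series gives
      T^(2t) (1 - q)^2 rho_1 = sum_(k <= n) q^(2k) - (t + 1) (1 + q^(2n))
    ([torus_rho1]).  The quotient of the difference of two consecutive right
    hand sides by (1 - q)^2 is the polynomial
      d_t = - (1 - T)^2 (sum_(k < n) (k + 1) T^(2k) + (t + 1) T^(2n)),
    and (1 + T)^2 d_t is -1 up to a multiple of T^(2n).  Hence the coefficients
    of d_t below T^(2n) are those of - 1 / (1 + T)^2 ([coef_expansion]).

    The Alexander polynomial is the symmetric multiple, by a unit, of a
    determinant with one row for each strand but the first.  It is computed by
    ordering the strands by height ([det_ranked]): all relations but one involve
    lower strands only, and the exceptional column, that of the closing arc, is
    replaced by a vector satisfying every relation but one ([det_replace_col],
    [det_alexander_torus]).  Symmetry then determines the unit up to sign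
    ([alexander_torus_sqr]). *)

(** * Laurent polynomials as shifted polynomials *)

Lemma T_neq0 : T != 0.
Proof. by rewrite tofrac_eq0 polyX_eq0. Qed.

(** The Laurent polynomial T^-m P. *)
Definition laurent (m : nat) (P : {poly int}) : lpoly :=
  [fsfun r in seq_fset tt [seq k%:Z - m%:Z | k <- iota 0 (size P)] =>
     P`_(absz (r + m%:Z))].

Lemma laurentE m P (k : nat) : laurent m P (k%:Z - m%:Z) = P`_k.
Proof.
rewrite fsfun_fun seq_fsetE subrK absz_nat.
case: ifP => // /negbT kP; apply/esym/nth_default; rewrite leqNgt.
by apply: contra kP => kP; apply: map_f; rewrite mem_iota.
Qed.

Lemma laurent_below m P (r : int) : r < - m%:Z -> laurent m P r = 0.
Proof.
move=> rm; rewrite fsfun_fun seq_fsetE; case: ifP => // /mapP[k _ rk]; lia.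
Qed.

Lemma laurent_neq0 m P r : laurent m P r != 0 ->
  exists2 k : nat, (k < size P)%N & r = k%:Z - m%:Z.
Proof.
rewrite fsfun_fun seq_fsetE; case: ifP => [|_]; last by rewrite eqxx.
by case/mapP => k; rewrite mem_iota add0n => /andP[_ kP] -> _; exists k.
Qed.

(** The sums in the definitions run over the exact support, which is awkward to
    compute; any duplicate-free list containing it may be used instead. *)
Lemma sum_finsupp (V : nmodType) (p : lpoly) (E : int -> V) (s : seq int) :
  uniq s -> (forall r, p r != 0 -> r \in s) -> (forall r, p r = 0 -> E r = 0) ->
  \sum_(r <- finsupp p) E r = \sum_(r <- s) E r.
Proof.
move=> us sub E0; rewrite [RHS](bigID (fun r => p r != 0)) /=.
rewrite [X in _ = _ + X]big1 ?addr0; last first.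
  by move=> r /negPn/eqP/E0.
rewrite -[RHS]big_filter; apply: perm_big; apply: uniq_perm.
- exact: fset_uniq.
- exact: filter_uniq.
move=> r; rewrite mem_finsupp mem_filter.
by case: eqP => //= /eqP/sub ->.
Qed.

Lemma sum_laurent (V : nmodType) m P (E : int -> V) :
  (forall r, laurent m P r = 0 -> E r = 0) ->
  \sum_(r <- finsupp (laurent m P)) E r = \sum_(k < size P) E (k%:Z - m%:Z).
Proof.
move=> E0; rewrite (@sum_finsupp _ _ _
  [seq k%:Z - m%:Z | k <- iota 0 (size P)]) //.
- rewrite big_map -(big_mkord xpredT (fun k => E (k%:Z - m%:Z))).
  by rewrite /index_iota subn0.
- by rewrite map_inj_uniq ?iota_uniq // => i j; lia.
by move=> r /laurent_neq0[k kP ->]; apply: map_f; rewrite mem_iota.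
Qed.

Lemma tofracC (z : int) : tofrac z%:P = z%:~R :> ratfun.
Proof. by rewrite -{1}[z]intz !rmorph_int. Qed.

Lemma lfrac_laurent m P : lfrac (laurent m P) = T ^ (- m%:Z) * tofrac P.
Proof.
rewrite /lfrac sum_laurent => [|r ->]; last by rewrite mul0r.
rewrite -[P in RHS]coefK poly_def rmorph_sum mulr_sumr; apply: eq_bigr => k _.
rewrite laurentE expfzDr ?T_neq0 // -mul_polyC rmorphM /= rmorphXn.
rewrite mulrA mulrC; congr (_ * _).
by rewrite tofracC.
Qed.

Lemma sum_coef_laurent m P :
  \sum_(r <- finsupp (laurent m P)) laurent m P r = P.[1].
Proof.
rewrite sum_laurent // horner_coef; apply: eq_bigr => k _.
by rewrite laurentE expr1n mulr1.
Qed.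

Lemma laurent_surj (p : lpoly) : exists m P, p = laurent m P.
Proof.
pose m := (\sum_(r <- finsupp p) absz r)%N.
have pm r : p r != 0 -> (absz r <= m)%N.
  rewrite -mem_finsupp => rp; rewrite /m (bigD1_seq r) ?fset_uniq //=.
  exact: leq_addr.
exists m, (\poly_(k < m.*2.+1) p (k%:Z - m%:Z)); apply/fsfunP => r.
have [rm|rm] := ltP r (- m%:Z).
  rewrite laurent_below //; apply/eqP/negPn/negP => /pm; lia.
have -> : r = (absz (r + m%:Z))%:Z - m%:Z by lia.
rewrite laurentE coef_poly; case: ifP => // /negbT mr.
by apply/eqP/negPn/negP => /pm; lia.
Qed.

Lemma laurent_mulXn m P a : laurent (m + a) ('X^a * P) = laurent m P.
Proof.
apply/fsfunP => r.
have [rm|rm] := ltP r (- (m + a)%N%:Z); first by rewrite !laurent_below //; lia.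
have -> : r = (absz (r + (m + a)%N%:Z)%R)%:Z - (m + a)%N%:Z by lia.
move: (absz _) => k; rewrite laurentE coefXnM; case: ltnP => ka.
  by rewrite laurent_below //; lia.
by rewrite -(laurentE m); congr (laurent m P _); lia.
Qed.

(** The coefficients of a Laurent polynomial can be read off its fraction: after
    multiplication by a large power of T both sides become polynomials, and
    polynomials embed in their fraction field. *)
Lemma lfrac_shift (p p' : lpoly) (s : bool) (k : int) :
  lfrac p = (-1) ^+ s * T ^ k * lfrac p' ->
  forall r, p r = (-1) ^+ s * p' (r - k).
Proof.
have [m [P ->]] := laurent_surj p; have [m' [P' ->]] := laurent_surj p'.
pose a := (m' + absz k)%N; pose b := absz ((m + a)%N%:Z + k - m'%:Z)%R.
rewrite -(laurent_mulXn m P a) -(laurent_mulXn m' P' b).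
move: ('X^a * P) ('X^b * P') => Q Q'; rewrite !lfrac_laurent.
have -> : - (m' + b)%N%:Z = - (m + a)%N%:Z - k by lia.
rewrite -mulrA [T ^ k * _]mulrA -expfzDr ?T_neq0 // addrCA subrr addr0.
rewrite mulrCA => /mulfI => /(_ (expfz_neq0 _ T_neq0)) eQ.
have -> : Q = (-1) ^+ s * Q'.
  by apply/eqP; rewrite -tofrac_eq eQ rmorphM rmorphXn rmorphN1.
move=> r; have [rm|rm] := ltP r (- (m + a)%N%:Z).
  by rewrite !laurent_below ?mulr0 //; lia.
have -> : r = (absz (r + (m + a)%N%:Z)%R)%:Z - (m + a)%N%:Z by lia.
move: (absz _) => i.
have -> : i%:Z - (m + a)%N%:Z - k = i%:Z - (m' + b)%N%:Z by lia.
rewrite !laurentE -[in LHS](rmorphN1 (polyC : _ -> {poly int})) -rmorphXn.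
by rewrite coefCM.
Qed.

(** * The series of -1 / (1 + T)^2 and the polynomials converging to it *)

(** Truncation of sum_k (k + 1) z^k = 1 / (1 - z)^2, which explains both
    [diff_poly], with z = T^2, and [expansion_coef], with z = - T. *)
Lemma sum_deriv_geom (R : comNzRingType) (z : R) n :
  (1 - z) ^+ 2 * \sum_(k < n) z ^+ k *+ k.+1
  = 1 - z ^+ n *+ n.+1 + z ^+ n.+1 *+ n.
Proof.
elim: n => [|n IH]; first by rewrite big_ord0 mulr0 mulr0n addr0 subrr.
rewrite big_ord_recr /= mulrDr IH !exprS; move: (z ^+ n) => w; ring.
Qed.

(** The difference d_t of the theorem, as a polynomial. *)
Definition diff_poly (t : nat) : {poly int} :=
  - (1 - 'X) ^+ 2 * (\sum_(k < t.*2.+1) 'X^2 ^+ k *+ k.+1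
                     + 'X^2 ^+ t.*2.+1 *+ t.+1).

Lemma diff_polyE t : let z : {poly int} := 'X^2 in
  (1 + 'X) ^+ 2 * diff_poly t
  = -1 + z ^+ t.*2.+1 * (t.+1%:R + z - z ^+ 2 *+ t.+1).
Proof.
move=> z; have := sum_deriv_geom z t.*2.+1; rewrite /diff_poly -/z.
move: (\sum_(k < _) _) => S eS.
have -> : (1 + 'X) ^+ 2 * (- (1 - 'X) ^+ 2 * (S + z ^+ t.*2.+1 *+ t.+1))
  = - ((1 - z) ^+ 2 * S) - (1 - z) ^+ 2 * (z ^+ t.*2.+1 *+ t.+1).
  by rewrite /z; ring.
rewrite eS [z ^+ t.*2.+2]exprS; move: (z ^+ t.*2.+1) => w.
by rewrite -addnn; ring.
Qed.

Definition expansion_coef (r : int) : int :=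
  if r is Posz k then - ((-1) ^+ k *+ k.+1) else 0.

Lemma expansion_coef_rec r : expansion_coef r + 2 * expansion_coef (r - 1)
  + expansion_coef (r - 2) = - (r == 0)%:R.
Proof.
case: r => [[|[|k]]|k] //.
  have -> : k.+2%:Z - 1 = k.+1%:Z by lia.
  have -> : k.+2%:Z - 2 = k%:Z by lia.
  by rewrite /= oppr0 !exprS; move: (_ ^+ k) => w; ring.
Qed.

Lemma sqr1DX : (1 + 'X) ^+ 2 = Poly [:: 1; 2; 1] :> {poly int}.
Proof. by rewrite /= !cons_poly_def; ring. Qed.

Lemma expansion_coefP :
  laurent_expansion (- (1 / (1 + T) ^+ 2)) expansion_coef.
Proof.
split; first by exists 0 => -[].
exists (-1), ((1 + 'X) ^+ 2); split.
- by rewrite sqr1DX -size_poly_eq0 (@PolyK _ 0).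
- by rewrite rmorphN1 rmorphXn rmorphD rmorph1 mulN1r div1r.
move=> r; rewrite sqr1DX (@PolyK _ 0) // !big_ord_recr big_ord0 /=.
rewrite add0r !mul1r subr0 expansion_coef_rec.
by case: r => k //; rewrite -polyCN coefC; case: k.
Qed.

(** A polynomial which agrees with -1 modulo T^m after multiplication by
    (1 + T)^2 satisfies, below degree m, the recurrence of the series. *)
Lemma coef_expansion (P W : {poly int}) m :
    (1 + 'X) ^+ 2 * P = -1 + 'X^m * W ->
  forall k, (k < m)%N -> P`_k = expansion_coef k.
Proof.
move=> eP k; elim/ltn_ind: k => k IH km.
have := congr1 (fun Q : {poly int} => Q`_k) eP.
have -> : (1 + 'X) ^+ 2 * P = P + 2 *: ('X * P) + 'X^2 * P.
  by rewrite scaler_nat; ring.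
rewrite [X in X = _]coefD !coefD coefZ coefXM !coefXnM km addr0 coefN coef1.
have -> : (if k == 0%N then 0 else P`_k.-1) = expansion_coef (k%:Z - 1).
  case: k IH km => [|k] IH km; first by [].
  by rewrite (IH k) // ?(ltnW km) //; congr expansion_coef; lia.
have -> : (if (k < 2)%N then 0 else P`_(k - 2)) = expansion_coef (k%:Z - 2).
  case: k IH km => [|[|k]] IH km; [by []|by []|].
  by rewrite subn2 (IH k) ?(ltnW (ltnW km)) //; congr expansion_coef; lia.
by rewrite -(expansion_coef_rec k) => /addIr/addIr.
Qed.

(** * Summing the crossing contributions *)

(** The closing arc contributes the term (1 - q) (1 - q^n), and the n + 1 halves
    add up to t + 1.  The cross terms telescope, since the exponents h and n - h
    exhaust 0, ..., n - 1 and 1, ..., n. *)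
Lemma sum_R1 (R : comNzRingType) (q : R) t : let n := t.*2.+1 in
  \sum_(h < n) (q ^+ (n - h) - q) * (q ^+ (n - h) - q ^+ h)
    + (1 - q) * (1 - q ^+ n) - (1 - q ^+ n) ^+ 2 *+ t.+1
  = \sum_(k < n.+1) (q ^+ 2) ^+ k - (1 + (q ^+ n) ^+ 2) *+ t.+1.
Proof.
move=> n; have e1 : \sum_(h < n) q ^+ (n - h) = \sum_(h < n) q ^+ h.+1.
  by rewrite (reindex_inj rev_ord_inj); apply: eq_bigr => h _ /=; rewrite subKn.
have e2 : \sum_(h < n) (q ^+ (n - h)) ^+ 2 = \sum_(h < n) (q ^+ 2) ^+ h.+1.
  rewrite (reindex_inj rev_ord_inj); apply: eq_bigr => h _ /=.
  by rewrite subKn // exprAC.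
have e3 : \sum_(h < n) q ^+ h.+1 + 1 = \sum_(h < n) q ^+ h + q ^+ n.
  by rewrite -[RHS](big_ord_recr _ (fun h => q ^+ h)) big_ord_recl /= addrC.
rewrite [in RHS]big_ord_recl /= expr0 -e2.
rewrite (eq_bigr (fun h : 'I_n =>
  (q ^+ (n - h)) ^+ 2 + q * (q ^+ h - q ^+ (n - h)) - q ^+ n)); last first.
  move=> h _; have -> : q ^+ n = q ^+ (n - h) * q ^+ h.
    by rewrite -exprD subnK // ltnW.
  by ring.
rewrite sumrB sumr_const card_ord big_split /= -mulr_sumr sumrB e1.
have -> : \sum_(h < n) q ^+ h.+1 = \sum_(h < n) q ^+ h + q ^+ n - 1.
  by rewrite -e3 addrK.
move: (\sum_(h < n) q ^+ h) (\sum_(h < n) _) (q ^+ n) => A B Q.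
by rewrite /n -addnn; ring.
Qed.

(** The shape of rho_1 on the torus diagram, in an arbitrary field: u stands for
    T^(2t), the squared sum for Delta^2 up to that factor. *)
Lemma rho1_closed (F : fieldType) (q u : F) t : let n := t.*2.+1 in
    1 - q != 0 -> 1 - q ^+ n != 0 -> 2 != 0 :> F -> u != 0 ->
  u * (u^-1 * (\sum_(k < n) q ^+ k) ^+ 2
       * (\sum_(h < n) ((q ^+ (n - h) - q) * (q ^+ (n - h) - q ^+ h)
                        / (1 - q ^+ n) ^+ 2 - 2^-1)
          - (2^-1 - (1 - q) / (1 - q ^+ n)))) * (1 - q) ^+ 2
  = \sum_(k < n.+1) (q ^+ 2) ^+ k - (1 + (q ^+ n) ^+ 2) *+ t.+1.
Proof.
move=> n q1 qn1 F2 u0; rewrite -sum_R1 -/n.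
have -> : \sum_(k < n) q ^+ k = (1 - q ^+ n) / (1 - q).
  apply: (mulfI q1); rewrite mulrCA divff // mulr1.
  by rewrite -[LHS]opprK -mulNr opprB -subrX1 opprB.
rewrite sumrB sumr_const card_ord -mulr_suml.
move: (\sum_(h < n) _) (q ^+ n) qn1 => S Q Q1.
by rewrite /n -addnn; field; apply/and4P.
Qed.

Lemma rho1_closed_diff (R : comNzRingType) (q : R) n t :
  let z := q ^+ 2 in
  let B m k := \sum_(i < m.+1) z ^+ i - (1 + (q ^+ m) ^+ 2) *+ k in
  B n.+2 t.+2 - B n t.+1 = -1 + z ^+ n * (t.+1%:R + z - z ^+ 2 *+ t.+1).
Proof.
move=> z B; rewrite /B !big_ord_recr /= ![(q ^+ _) ^+ 2]exprAC -/z.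
rewrite [z ^+ n.+2]exprS [z ^+ n.+1]exprS.
by move: (\sum_(i < n) _) (z ^+ n) => S w; ring.
Qed.

(** * The Green function of a diagram *)

Definition crossing_code (c : crossing) := (sgn c, over c, under c).

Lemma crossing_codeK :
  cancel crossing_code (fun x => Crossing x.1.1 x.1.2 x.2).
Proof. by case. Qed.

HB.instance Definition _ := Equality.copy crossing (can_type crossing_codeK).

Definition incoming (s : seq crossing) : seq nat :=
  flatten [seq [:: over c; under c] | c <- s].

Section SumCrossings.
Variables (V : nmodType) (F H : crossing -> V).

(** Both the transition matrix and the Alexander matrix are sums over crossings
    whose k-th row only involves the crossing which strand k enters; this is
    the shape of such a row. *)
Definition at_strand k c : V :=
  if k == over c then F c else if k == under c then H c else 0.

Lemma sum_at_strand_out s k :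
  k \notin incoming s -> \sum_(c <- s) at_strand k c = 0.
Proof.
elim: s => [|c s IH]; first by rewrite big_nil.
rewrite /incoming /= !inE !negb_or => /and3P[ko ku /IH sk].
by rewrite big_cons sk /at_strand (negPf ko) (negPf ku) addr0.
Qed.

Lemma sum_at_strand s c k : uniq (incoming s) -> c \in s ->
  k \in [:: over c; under c] -> \sum_(c' <- s) at_strand k c' = at_strand k c.
Proof.
elim: s => // c' s IH; rewrite big_cons [c \in _]inE /incoming /= inE negb_or.
rewrite -andbA; case/and4P=> ou os us uqs /predU1P[-> kc|cs kc].
  rewrite sum_at_strand_out ?addr0 //; move: kc; rewrite !inE.
  by case/orP => /eqP ->.
have ks : k \in incoming s by apply/flatten_mapP; exists c.
rewrite IH // {1}/at_strand ifN ?ifN ?add0r //.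
- by apply: contraNneq us => <-.
- by apply: contraNneq os => <-.
Qed.

End SumCrossings.

Section GreenFunction.
Variable D : diagram.
Let N := size (crossings D).

Lemma perm_incoming : perm_eq (incoming (crossings D)) (iota 1 N.*2).
Proof. by rewrite /N; case: D. Qed.

Lemma uniq_incoming : uniq (incoming (crossings D)).
Proof. by rewrite (perm_uniq perm_incoming) iota_uniq. Qed.

Lemma over_bound c : c \in crossings D -> (0 < over c <= N.*2)%N.
Proof.
move=> cD; have : over c \in incoming (crossings D).
  by apply/flatten_mapP; exists c; rewrite // mem_head.
by rewrite (perm_mem perm_incoming) mem_iota add1n ltnS.
Qed.

Lemma under_bound c : c \in crossings D -> (0 < under c <= N.*2)%N.
Proof.
move=> cD; have : under c \in incoming (crossings D).
  by apply/flatten_mapP; exists c; rewrite // !inE eqxx orbT.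
by rewrite (perm_mem perm_incoming) mem_iota add1n ltnS.
Qed.

Lemma over_neq_under c : c \in crossings D -> over c != under c.
Proof.
have := uniq_incoming; elim: (crossings D) => // c' s IH.
rewrite /incoming /= !inE negb_or -andbA => /and4P[ou _ _ us].
by case/predU1P=> [->|/IH->].
Qed.

Lemma crossing_at k : (0 < k <= N.*2)%N ->
  exists2 c, c \in crossings D & k \in [:: over c; under c].
Proof.
move=> kN; apply/flatten_mapP.
by rewrite (perm_mem perm_incoming) mem_iota add1n ltnS.
Qed.

Lemma strandK k : (0 < k <= N.*2.+1)%N -> (strand D k).+1 = k.
Proof. by case: k => // k kN; rewrite /strand inordK. Qed.

Lemma strand_eq (i : 'I_N.*2.+1) k :
  (0 < k <= N.*2.+1)%N -> (i == strand D k) = (i.+1 == k).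
Proof. by move=> kN; rewrite -{2}(strandK kN) eqSS. Qed.

Variable g : nat -> nat -> ratfun.
Hypothesis g_over : forall c l, c \in crossings D -> (0 < l <= N.*2.+1)%N ->
  g (over c) l = (over c == l)%:R
    + (T ^ sgn c * g (over c).+1 l + (1 - T ^ sgn c) * g (under c).+1 l).
Hypothesis g_under : forall c l, c \in crossings D -> (0 < l <= N.*2.+1)%N ->
  g (under c) l = (under c == l)%:R + g (under c).+1 l.
Hypothesis g_last : forall l, (0 < l <= N.*2.+1)%N ->
  g N.*2.+1 l = (N.*2.+1 == l)%:R.

(** The recurrences say that (1 - A) G = 1 for the matrix G of values of g.  A
    one-sided inverse of a square matrix is the inverse, so nothing has to be
    known beforehand about the invertibility of 1 - A. *)
Lemma green_unique k l : (0 < k <= N.*2.+1)%N -> (0 < l <= N.*2.+1)%N ->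
  green D k l = g k l.
Proof.
pose G : 'M[ratfun]_(N.*2.+1) := \matrix_(i, j) g i.+1 j.+1.
have delta_mul (a b i j : 'I_N.*2.+1) :
    (delta_mx a b *m G) i j = (i == a)%:R * g b.+1 j.+1.
  rewrite !mxE (bigD1 b) //= big1 => [|m mb].
    by rewrite !mxE eqxx andbT addr0.
  by rewrite !mxE (negPf mb) andbF mul0r.
have eG : (1%:M - transition_mx D) *m G = 1%:M.
  apply/matrixP => i j; rewrite mulmxBl mul1mx [LHS]mxE [X in _ + X]mxE.
  have jN : (0 < j.+1 <= N.*2.+1)%N by rewrite /= ltn_ord.
  pose F c := T ^ sgn c * g (over c).+1 j.+1
    + (1 - T ^ sgn c) * g (under c).+1 j.+1.
  have -> : (transition_mx D *m G) i j = \sum_(c <- crossings D)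
     at_strand F (fun c => g (under c).+1 j.+1) i.+1 c.
    rewrite /transition_mx mulmx_suml summxE.
    apply: eq_big_seq => c cD; have := over_bound cD; have := under_bound cD.
    have := over_neq_under cD => ou uN oN.
    rewrite !mulmxDl -!scalemxAl mxE [X in X + _]mxE.
    rewrite [X in X + _ + _]mxE [X in _ + X + _]mxE !delta_mul
      !strand_eq ?strandK; try lia.
    rewrite /at_strand /F; case: eqVneq => [->|_].
      by rewrite (negPf ou) !mul1r mul0r addr0.
    by case: eqP => _; rewrite !(mul0r, mulr0, mul1r, add0r, addr0).
  rewrite !mxE -[i == j]/(i.+1 == j.+1); have [iN|iN] := leqP i.+1 N.*2.
    have [|c cD ic] := @crossing_at i.+1; first by rewrite iN.
    rewrite (sum_at_strand _ _ uniq_incoming cD ic) /at_strand.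
    move: ic; rewrite !inE; case: eqP => [->|_ /= /eqP ->].
      by rewrite g_over // addrK.
    by rewrite eqxx g_under // addrK.
  rewrite sum_at_strand_out ?subr0; last first.
    by rewrite (perm_mem perm_incoming) mem_iota; lia.
  have -> : i.+1 = N.*2.+1 by move: (ltn_ord i); lia.
  by rewrite g_last.
move=> kN lN; have [uA _] := mulmx1_unit eG.
have -> : green D k l = G (strand D k) (strand D l).
  by rewrite /green /green_mx -[G](mulKmx uA) eG mulmx1.
by rewrite mxE !strandK.
Qed.

End GreenFunction.

(** * Strand labels and visit counts for the two-strand torus braid *)

(** Labels of the strands entering the h-th crossing from below.  Strands are
    numbered 1, ..., n on the first passage through the braid and n + 1, ...,
    2n on the second, and the two passages alternate in going over.  For h = n
    these are the labels at the top, and the formula remains meaningful: the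
    over-strand is the end 2n + 1 of the long knot and the under-strand is the
    closing arc n + 1, which is also the under-strand at level 0. *)
Definition over_label n h : nat := if odd h then (n.+1 + h)%N else h.+1.
Definition under_label n h : nat := if odd h then h.+1 else (n.+1 + h)%N.

(** Inverse of the two labellings; the closing arc, which is met at both ends of
    the braid, counts as its lower end. *)
Definition level n k : nat := if (k <= n)%N then k.-1 else (k - n.+1)%N.
Definition is_over n k : bool := odd (level n k) == (n < k)%N.

Section Labels.
Variable n : nat.

Lemma over_label_range h : (h <= n)%N -> (0 < over_label n h <= n.*2.+1)%N.
Proof. by rewrite /over_label; case: odd; lia. Qed.

Lemma under_label_range h : (h < n)%N -> (0 < under_label n h <= n.*2.+1)%N.
Proof. by rewrite /under_label; case: odd; lia. Qed.

Hypothesis n_odd : odd n.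

Lemma level_over h : (h <= n)%N -> level n (over_label n h) = h.
Proof. rewrite /level /over_label; case: ifP; case: ifP; lia. Qed.

Lemma level_under h : (h < n)%N -> level n (under_label n h) = h.
Proof. rewrite /level /under_label; case: ifP; case: ifP; lia. Qed.

Lemma is_over_over h : (h <= n)%N -> is_over n (over_label n h).
Proof.
move=> hn; rewrite /is_over level_over // /over_label.
case: (boolP (odd h)) => oh; lia.
Qed.

Lemma is_over_under h : (h < n)%N -> is_over n (under_label n h) = false.
Proof.
move=> hn; rewrite /is_over level_under // /under_label.
case: (boolP (odd h)) => oh; lia.
Qed.

Lemma over_labelS h : (over_label n h).+1 = under_label n h.+1.
Proof. by rewrite /over_label /under_label oddS addnS; case: (odd h). Qed.

Lemma under_labelS h : (under_label n h).+1 = over_label n h.+1.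
Proof. by rewrite /over_label /under_label oddS addnS; case: (odd h). Qed.

Lemma under_label_wrap : under_label n n = under_label n 0.
Proof. by rewrite /under_label n_odd addn0. Qed.

Lemma labelP k : (0 < k <= n.*2.+1)%N ->
  if is_over n k then (level n k <= n)%N && (k == over_label n (level n k))
  else (level n k < n)%N && (k == under_label n (level n k)).
Proof.
move=> kn; rewrite /is_over /over_label /under_label /level.
case: (leqP k n) => nk; case: (boolP (odd _)) => o /=; lia.
Qed.

Lemma over_label_eq h l : (h <= n)%N -> (0 < l <= n.*2.+1)%N ->
  (over_label n h == l) = is_over n l && (h == level n l).
Proof.
move=> hn /labelP lP; apply/eqP/andP => [<-|[lo /eqP ->]].
  by rewrite is_over_over ?level_over.
by move: lP; rewrite lo => /andP[_ /eqP].
Qed.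

Lemma under_label_eq h l : (h < n)%N -> (0 < l <= n.*2.+1)%N ->
  (under_label n h == l) = ~~ is_over n l && (h == level n l).
Proof.
move=> hn /labelP lP; apply/eqP/andP => [<-|[lo /eqP ->]].
  by rewrite is_over_under ?level_under.
by move: lP; rewrite (negPf lo) => /andP[_ /eqP].
Qed.

End Labels.

Section Visits.
Variables (F : fieldType) (q : F) (n : nat).
Hypothesis q1 : 1 - q != 0.
Hypothesis qn1 : 1 - q ^+ n != 0.

(** [arc_visits o m] is the number of visits, starting from the closing arc, to
    the strand entering level m as an over-strand if o holds and as an
    under-strand otherwise.  It is the constant fixed by the identification of
    the under-strands at the levels n and 0. *)
Definition arc_visits (o : bool) m : F :=
  (if o then 1 - q ^+ m else q ^+ m - q) / (1 - q ^+ n).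

(** With x and y the visits starting from the over- and the under-strand at
    level h, [gap] is x - y and [mass] is x - q y = x + T y.  Descending one
    level multiplies the first by q and preserves the second; crossing the
    source adds (1, 1) or (-1, -q) to them.  At the top, where y is [arc_visits]
    and x vanishes, they are - [arc_visits] and - q [arc_visits]. *)
Definition gap (o : bool) m h : F :=
  - q ^+ (n - h) * arc_visits o m
  + (if (h <= m)%N then (if o then 1 else -1) * q ^+ (m - h) else 0).
Definition mass (o : bool) m h : F :=
  - q * arc_visits o m + (if (h <= m)%N then (if o then 1 else - q) else 0).

(** Visits to the strand (o, m) starting from the over-strand at level h if
    [a] holds, and from the under-strand otherwise. *)
Definition visits (a o : bool) m h : F :=
  (mass o m h - (if a then q else 1) * gap o m h) / (1 - q).

Lemma gapS o m h : (h < n)%N ->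
  gap o m h = (if o then 1 else -1) * (h == m)%:R + q * gap o m h.+1.
Proof.
move=> hn; rewrite /gap -(subnSK hn) exprS; move: (q ^+ (n - h.+1)) => u.
case: (ltngtP h m) => [hm|mh|->].
- by rewrite -(subnSK hm) exprS; move: (q ^+ _) => v /=; ring.
- by move=> /=; ring.
- by rewrite subnn expr0 /=; ring.
Qed.

Lemma massS o m h :
  mass o m h = (if o then 1 else - q) * (h == m)%:R + mass o m h.+1.
Proof. by rewrite /mass; case: (ltngtP h m) => _ /=; ring. Qed.

Lemma visits_over o m h : (h < n)%N ->
  visits true o m h = (o && (h == m))%:R
    + (- q * visits false o m h.+1 + (1 + q) * visits true o m h.+1).
Proof.
move=> hn; rewrite /visits gapS // massS.
by case: o; case: (h == m) => /=; field.
Qed.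

Lemma visits_under o m h : (h < n)%N ->
  visits false o m h = (~~ o && (h == m))%:R + visits true o m h.+1.
Proof.
move=> hn; rewrite /visits gapS // massS.
by case: o; case: (h == m) => /=; field.
Qed.

(** The closing arc can be seen at either end of the braid; this is where the
    value of [arc_visits] is used. *)
Lemma visits_wrap (o : bool) m : (if o then m <= n else m < n)%N ->
  visits false o m n = visits false o m 0.
Proof.
move=> mn; rewrite /visits /mass /gap /arc_visits subnn !subn0 /= expr0.
case: o mn => [|mn].
  rewrite leq_eqVlt => /predU1P[->|mn].
    by rewrite leqnn subnn expr0; field; apply/andP.
  by rewrite leqNgt mn /=; field; apply/andP.
by rewrite leqNgt mn /=; field; apply/andP.
Qed.

Lemma visits_last (o : bool) m : (if o then m <= n else m < n)%N ->
  visits true o m n = (o && (n == m))%:R.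
Proof.
move=> mn; rewrite /visits /mass /gap /arc_visits subnn /= expr0.
case: o mn => [|mn].
  rewrite leq_eqVlt => /predU1P[->|mn].
    by rewrite leqnn subnn expr0 eqxx /=; field; apply/andP.
  by rewrite leqNgt mn gtn_eqF //=; field; apply/andP.
by rewrite leqNgt mn /=; field; apply/andP.
Qed.

End Visits.

(** * The Green function in closed form *)

(** The denominators 1 + T, here, and 1 + T^n, next, do not vanish since they
    take the value 2 at T = 1. *)
Lemma one_sub_oppT_neq0 : 1 - - T != 0 :> ratfun.
Proof.
have -> : 1 - - T = tofrac (1 + 'X) by rewrite opprK rmorphD rmorph1.
rewrite tofrac_eq0; apply/eqP => /(congr1 (fun p : {poly int} => p.[1])).
by rewrite hornerD hornerC hornerX horner0.
Qed.

Lemma one_sub_oppTn_neq0 n : odd n -> 1 - (- T) ^+ n != 0 :> ratfun.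
Proof.
move=> n_odd; have -> : 1 - (- T) ^+ n = tofrac (1 + 'X^n).
  by rewrite exprNn -signr_odd n_odd mulN1r opprK rmorphD rmorphXn rmorph1.
rewrite tofrac_eq0; apply/eqP => /(congr1 (fun p : {poly int} => p.[1])).
by rewrite hornerD hornerC hornerXn expr1n horner0.
Qed.

Section TorusGreen.
Variables (F : fieldType) (q : F) (n : nat).
Hypothesis n_odd : odd n.
Hypothesis q1 : 1 - q != 0.
Hypothesis qn1 : 1 - q ^+ n != 0.

Definition torus_green k l : F :=
  visits q n (is_over n k) (is_over n l) (level n l) (level n k).

Lemma torus_green_overE h l : (h <= n)%N ->
  torus_green (over_label n h) l = visits q n true (is_over n l) (level n l) h.
Proof. by move=> hn; rewrite /torus_green is_over_over ?level_over. Qed.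

Lemma level_le l : (0 < l <= n.*2.+1)%N ->
  (if is_over n l then level n l <= n else level n l < n)%N.
Proof. by move/(labelP n_odd); case: ifP => _ /andP[]. Qed.

Lemma torus_green_underE h l : (h <= n)%N -> (0 < l <= n.*2.+1)%N ->
  torus_green (under_label n h) l
  = visits q n false (is_over n l) (level n l) h.
Proof.
rewrite leq_eqVlt => /predU1P[->|hn] ln; last first.
  by rewrite /torus_green is_over_under ?level_under.
rewrite under_label_wrap // /torus_green is_over_under ?level_under ?odd_gt0 //.
by apply/esym/visits_wrap => //; apply: level_le.
Qed.

Lemma torus_green_over h l : (h < n)%N -> (0 < l <= n.*2.+1)%N ->
  torus_green (over_label n h) l = (over_label n h == l)%:R
    + (- q * torus_green (over_label n h).+1 l
       + (1 + q) * torus_green (under_label n h).+1 l).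
Proof.
move=> hn ln; rewrite over_labelS under_labelS !torus_green_overE ?(ltnW hn) //.
by rewrite torus_green_underE // over_label_eq ?(ltnW hn) // -visits_over.
Qed.

Lemma torus_green_under h l : (h < n)%N -> (0 < l <= n.*2.+1)%N ->
  torus_green (under_label n h) l
  = (under_label n h == l)%:R + torus_green (under_label n h).+1 l.
Proof.
move=> hn ln; rewrite under_labelS torus_green_overE //.
rewrite torus_green_underE ?(ltnW hn) //.
by rewrite under_label_eq // -visits_under.
Qed.

Lemma torus_green_last l : (0 < l <= n.*2.+1)%N ->
  torus_green n.*2.+1 l = (n.*2.+1 == l)%:R.
Proof.
move=> ln; have -> : n.*2.+1 = over_label n n.
  by rewrite /over_label n_odd -addnn addSn.
by rewrite torus_green_overE // visits_last ?level_le // over_label_eq.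
Qed.

Lemma torus_green_arc : torus_green n.+1 n.+1 = (1 - q) / (1 - q ^+ n).
Proof.
have n0 : (0 < n)%N by rewrite odd_gt0.
have -> : n.+1 = under_label n 0 by rewrite /under_label addn0.
rewrite torus_green_underE ?under_label_range //.
rewrite is_over_under ?level_under // -visits_wrap //.
rewrite /visits /mass /gap /arc_visits subnn leqNgt n0 /= expr0.
by field; apply/andP.
Qed.

(** The collapse which makes rho_1 summable: both products of Green functions
    are quadratic in e and f with long coefficients, but their difference is a
    multiple of (f - q) (f - e). *)
Lemma torus_green_R1 h : (h < n)%N ->
  let e := q ^+ h in let f := q ^+ (n - h) in
  let g := torus_green in let i := over_label n h in let j := under_label n h in
  g j i * (g j.+1 j + g j j.+1 - g i j) - g i i * (g j j.+1 - 1)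
  = (f - q) * (f - e) / (1 - q ^+ n) ^+ 2.
Proof.
move=> hn e f g i j; have hn' := ltnW hn.
have ef : q ^+ n = e * f by rewrite -exprD subnKC.
have ef0 : 1 - e * f != 0 by rewrite -ef.
have fu : f = q * q ^+ (n - h.+1) by rewrite -exprS subnSK.
rewrite /g /i /j under_labelS.
rewrite !torus_green_overE ?torus_green_underE
  ?over_label_range ?under_label_range //.
rewrite !is_over_over ?is_over_under ?level_over ?level_under //.
rewrite /visits /mass /gap /arc_visits !leqnn !ltnn leqnSn !subnn subSnn.
rewrite expr0 expr1.
rewrite -/f exprS -/e ef; move: ef => _.
move: e (q ^+ (n - h.+1)) f fu ef0 => a u _ -> {}ef0.
by field; apply/andP.
Qed.


End TorusGreen.

(** * The terms of rho_1 on the torus diagram *)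

Section TorusKnot.
Variable t : nat.
Let n := t.*2.+1.
Let q : ratfun := - T.
Let D := torus_diagram t.

Let n_odd : odd n. Proof. by rewrite /n /= odd_double. Qed.
Let q1 : 1 - q != 0 := one_sub_oppT_neq0.
Let qn1 : 1 - q ^+ n != 0 := one_sub_oppTn_neq0 n_odd.

Lemma torus_size : size (crossings D) = n.
Proof. by rewrite size_mkseq. Qed.

Lemma torus_crossingsE : crossings D =
  [seq Crossing 1 (over_label n h) (under_label n h) | h <- iota 0 n].
Proof.
by apply: eq_map => h; rewrite /over_label /under_label; case: odd.
Qed.

Lemma torus_crossingP c : reflect
  (exists2 h, (h < n)%N & c = Crossing 1 (over_label n h) (under_label n h))
  (c \in crossings D).
Proof.
rewrite torus_crossingsE; apply: (iffP mapP) => [[h]|[h hn ->]].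
  by rewrite mem_iota => hn ->; exists h.
by exists h; rewrite ?mem_iota.
Qed.

Lemma green_torus k l : (0 < k <= n.*2.+1)%N -> (0 < l <= n.*2.+1)%N ->
  green D k l = torus_green q n k l.
Proof.
move=> kn ln; apply: (@green_unique D (torus_green q n)).
- move=> c m /torus_crossingP[h hn ->]; rewrite torus_size => mn.
  rewrite [over _]/= [under _]/= [sgn _]/= expr1z.
  by rewrite (torus_green_over n_odd q1 qn1 hn mn) [- q]opprK.
- move=> c m /torus_crossingP[h hn ->]; rewrite torus_size => mn.
  exact: (torus_green_under n_odd q1 qn1 hn mn).
- move=> m; rewrite torus_size => mn.
  exact: (torus_green_last n_odd q1 qn1 mn).
- by rewrite torus_size.
by rewrite torus_size.
Qed.

Lemma torus_R1 h : (h < n)%N ->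
  R1 D (Crossing 1 (over_label n h) (under_label n h))
  = (q ^+ (n - h) - q) * (q ^+ (n - h) - q ^+ h) / (1 - q ^+ n) ^+ 2 - 2^-1.
Proof.
move=> hn; rewrite /R1 [over _]/= [under _]/= [sgn _]/= mul1r under_labelS.
rewrite !green_torus ?over_label_range ?under_label_range ?(ltnW hn) //.
rewrite -under_labelS; congr (_ - _).
exact: (torus_green_R1 n_odd q1 qn1 hn).
Qed.

Lemma torus_turning :
  \sum_(1 <= k < (size (crossings D)).*2.+2)
    (turning D k)%:~R * (green D k k - 2^-1)
  = 2^-1 - (1 - q) / (1 - q ^+ n).
Proof.
rewrite torus_size (bigD1_seq n.+1) ?iota_uniq ?mem_index_iota //=; last by lia.
rewrite big1_seq ?addr0 => [|k /andP[/negPf kn _]]; last by rewrite kn mul0r.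
rewrite eqxx mulN1r opprB green_torus; try lia.
by rewrite (torus_green_arc n_odd q1 qn1).
Qed.

End TorusKnot.

(** * Determinants and Alexander matrices *)

(** A permutation contributing to the determinant never raises the rank of an
    index, and strictly lowers it wherever it moves one; the sum of the ranks
    being invariant, only the identity contributes.  This is the triangular
    case, without reordering the indices. *)
Lemma det_ranked (R : comNzRingType) m (A : 'M[R]_m) (r : 'I_m -> nat) :
  (forall i j, A i j != 0 -> i != j -> (r j < r i)%N) ->
  \det A = \prod_i A i i.
Proof.
move=> rA; rewrite /determinant (bigD1 (1%g : {perm 'I_m})) //=.
rewrite odd_perm1 expr0 mul1r.
rewrite [X in _ + X]big1 ?addr0 => [|s s1].
  by apply: eq_bigr => i _; rewrite perm1.
have [/existsP[i /eqP si]|/existsPn nz] := boolP [exists i, A i (s i) == 0].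
  by rewrite (bigD1 i) //= si mul0r mulr0.
have rs i : (r (s i) <= r i)%N.
  by have [{1}->//|si] := eqVneq (s i) i; rewrite ltnW // rA // eq_sym.
have sum_eq : (\sum_i r (s i) = \sum_i r i)%N.
  by rewrite [RHS](reindex_inj (@perm_inj _ s)).
case/eqP: s1; apply/permP => i; rewrite perm1; apply/eqP/negPn/negP => si.
have : (\sum_i r (s i) < \sum_i r i)%N.
  rewrite (bigD1 i) //= [X in (_ < X)%N](bigD1 i) //= -addSn leq_add //.
    by rewrite rA // eq_sym.
  by apply: leq_sum.
by rewrite sum_eq ltnn.
Qed.

(** Right multiplication by the identity matrix whose c-th column is replaced by
    v, a matrix of determinant v_c. *)
Lemma det_replace_col (R : comNzRingType) m (A : 'M[R]_m) (v : 'cV[R]_m) c :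
  v c 0 = 1 ->
  \det A = \det (\matrix_(i, j) if j == c then (A *m v) i 0 else A i j).
Proof.
move=> vc; pose V := \matrix_(i, j) if j == c then v i 0 else (i == j)%:R.
have detV : \det V = 1.
  rewrite (@det_ranked _ _ _ (fun i => (i != c) : nat)).
    by rewrite big1 // => i _; rewrite mxE eqxx; case: eqP => [->|].
  move=> i j; rewrite mxE; case: (eqVneq j c) => [-> _ -> //|jc].
  by case: (eqVneq i j) => //; rewrite eqxx.
rewrite -[LHS]mulr1 -detV -det_mulmx; congr (\det _); apply/matrixP => i j.
rewrite !mxE; case: (eqVneq j c) => [->|jc].
  by apply: eq_bigr => k _; rewrite !mxE eqxx.
rewrite (bigD1 j) //= big1 => [|k kj]; rewrite !mxE (negPf jc).
  by rewrite eqxx mulr1 addr0.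
by rewrite (negPf kj) mulr0.
Qed.

Section AlexanderRows.
Variable D : diagram.
Let N := size (crossings D).

Lemma alexander_row c (i : 'I_N.*2) (j : 'I_N.*2.+1) : c \in crossings D ->
  i.+1 \in [:: over c; under c] ->
  alexander_mx D i j = (j.+1 == i.+2)%:R -
    (if i.+1 == over c then (j.+1 == over c)%:R
     else T ^ sgn c * (j.+1 == under c)%:R
          + (1 - T ^ sgn c) * (j.+1 == over c)%:R).
Proof.
move=> cD ic; rewrite mxE.
have -> : forall s (F H : crossing -> 'rV[ratfun]_N.*2.+1),
    \sum_(c <- s) (if i.+1 == over c then F c
      else if i.+1 == under c then H c else 0)
    = \sum_(c <- s) at_strand F H i.+1 c by [].
rewrite (sum_at_strand _ _ (uniq_incoming D) cD ic) /at_strand.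
have := over_bound cD; have := under_bound cD => uN oN.
move: ic; rewrite !inE; case: eqP => [-> _|_ /= /eqP ->].
  by rewrite !mxE !strand_eq //; lia.
by rewrite eqxx !mxE !strand_eq //; lia.
Qed.

(** Pairing a row with a vector indexed by strand labels evaluates the Wirtinger
    relation of that row on the vector. *)
Lemma alexander_row_mul c (i : 'I_N.*2) (w : nat -> ratfun) :
  c \in crossings D -> i.+1 \in [:: over c; under c] ->
  \sum_j alexander_mx D i j * w j.+1 = w i.+2 -
    (if i.+1 == over c then w (over c)
     else T ^ sgn c * w (under c) + (1 - T ^ sgn c) * w (over c)).
Proof.
move=> cD ic; have := over_bound cD; have := under_bound cD => uN oN.
have delta k : (0 < k <= N.*2.+1)%N ->
    \sum_(j < N.*2.+1) (j.+1 == k)%:R * w j.+1 = w k.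
  move=> kN; rewrite (bigD1 (strand D k)) //= big1 => [|j jk].
    by rewrite strandK // eqxx mul1r addr0.
  by rewrite strand_eq // in jk; rewrite (negPf jk) mul0r.
under eq_bigr do rewrite (alexander_row _ cD ic) mulrBl.
rewrite sumrB delta; last by move: (ltn_ord i); lia.
congr (_ - _); case: ifP => _; first by rewrite delta //; lia.
under eq_bigr do rewrite mulrDl -!mulrA.
by rewrite big_split /= -!mulr_sumr !delta //; lia.
Qed.

End AlexanderRows.

(** * The Alexander polynomial of the torus diagram *)

Section TorusAlexander.
Variable t : nat.
Let n := t.*2.+1.
Let q : ratfun := - T.
Let D := torus_diagram t.
Let N := size (crossings D).

Let n_odd : odd n. Proof. by rewrite /n /= odd_double. Qed.
Let N_eq : N = n. Proof. exact: torus_size. Qed.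

(** The value at level h of the solution of the Wirtinger relations with value 0
    on strand 1 and 1 on the closing arc, propagated upwards from level 0.  The
    under-strand at level h has this value; the over-strand, which becomes the
    under-strand of the next level, has the value at h + 1.  Back at the closing
    arc, the defect 1 - [propagated n] is the determinant. *)
Definition propagated h : ratfun := 1 - \sum_(j < h) q ^+ j.

Lemma propagated_rec h :
  propagated h.+2 = T * propagated h + (1 - T) * propagated h.+1.
Proof.
rewrite /propagated !big_ord_recr /= [q ^+ h.+1]exprS /q.
move: (\sum_(j < h) _) (_ ^+ h) => S w; ring.
Qed.

Lemma det_alexander_torus :
  \det (col' ord0 (alexander_mx D)) = \sum_(k < n) q ^+ k.
Proof.
(* The propagated solution by strand label, cut at the closing arc. *)
pose w k := propagated (level n k + is_over n k).
have w_over h : (h <= n)%N -> w (over_label n h) = propagated h.+1.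
  by move=> hn; rewrite /w is_over_over ?level_over // addn1.
have w_under h : (h < n)%N -> w (under_label n h) = propagated h.
  by move=> hn; rewrite /w is_over_under ?level_under // addn0.
have w_arc : w n.+1 = 1.
  have -> : n.+1 = under_label n 0 by rewrite /under_label addn0.
  by rewrite w_under // /propagated big_ord0 subr0.
have w_1 : w 1%N = 0.
  have -> : 1%N = over_label n 0 by [].
  by rewrite w_over // /propagated big_ord1 subrr.
(* Column i of the reduced matrix belongs to strand i + 2, as does row i, whose
   relation expresses that strand; c is the index of the closing arc n + 1. *)
have cN : (n.-1 < N.*2)%N by rewrite N_eq; lia.
pose c : 'I_N.*2 := Ordinal cN.
pose v : 'cV[ratfun]_N.*2 := \col_j w j.+2.
rewrite (@det_replace_col _ _ (col' ord0 (alexander_mx D)) v c); last first.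
  by rewrite mxE.
have rowE (i : 'I_N.*2) : exists h, [/\ (h < n)%N,
      (i.+2 == under_label n h.+1) || (i.+2 == over_label n h.+1),
      (col' ord0 (alexander_mx D) *m v) i 0
        = (i == c)%:R * (\sum_(k < n) q ^+ k)
    & forall j : 'I_N.*2, j.+2 != over_label n h -> j.+2 != under_label n h ->
      col' ord0 (alexander_mx D) i j = (j == i)%:R].
  have iN : (0 < i.+1 <= N.*2)%N by rewrite /= ltn_ord.
  have [cr crD ic] := crossing_at iN.
  have /torus_crossingP[h hn ecr] := crD.
  have mulE : (col' ord0 (alexander_mx D) *m v) i 0 =
      \sum_j alexander_mx D i j * w j.+1.
    rewrite [RHS]big_ord_recl w_1 mulr0 add0r mxE.
    by apply: eq_bigr => j _; rewrite !mxE.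
  exists h; rewrite mulE (alexander_row_mul w crD ic); split=> //.
  - rewrite -over_labelS -under_labelS !eqSS.
    by move: ic; rewrite ecr !inE.
  - move: ic; rewrite ecr !inE [over _]/= [under _]/= [sgn _]/= expr1z.
    have icE : (i == c) = (i.+1 == n) by [].
    rewrite icE; case: eqP => [io _|_ /= /eqP iu]; last first.
      rewrite iu under_labelS w_under // !w_over ?(ltnW hn) // propagated_rec.
      rewrite subrr (_ : _ == n = false) ?mul0r //.
      by rewrite /under_label; case: (boolP (odd h)); lia.
    rewrite io over_labelS w_over ?(ltnW hn) //.
    have [hn1|hn1] := ltnP h.+1 n.
      rewrite w_under // subrr (_ : _ == n = false) ?mul0r //.
      by rewrite /over_label; case: (boolP (odd h)); lia.
    have eh : h.+1 = n by apply/eqP; rewrite eqn_leq hn hn1.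
    rewrite eh /under_label n_odd w_arc /propagated subKr.
    have -> : over_label n h = n; last by rewrite eqxx mul1r.
    by rewrite /over_label; case: (boolP (odd h)); lia.
  move=> j jo ju; rewrite mxE (alexander_row _ crD ic) ecr.
  rewrite [over _]/= [under _]/= [sgn _]/=.
  rewrite /= /bump leq0n add1n (negPf jo) (negPf ju) !mulr0 addr0 if_same subr0.
  by [].
(* Heights, except that the closing arc counts as the top of the braid, where
   its own relation is. *)
rewrite (@det_ranked _ _ _
  (fun j : 'I_N.*2 => if j.+2 == n.+1 then n else level n j.+2)); last first.
  move=> i j; rewrite mxE; have [h [hn il mulE entE]] := rowE i.
  case: (eqVneq j c) => [->|jc].
    rewrite mulE; case: (eqVneq i c) => [-> _|_]; first by rewrite eqxx.
    by rewrite mul0r eqxx.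
  have ri : (h < if i.+2 == n.+1 then n else level n i.+2)%N.
    have [//|iarc] := eqVneq i.+2 n.+1; case/orP: il => /eqP il; last first.
      by rewrite il level_over.
    rewrite il level_under // ltn_neqAle hn andbT.
    by apply: contraNneq iarc => hn1; rewrite il hn1 /under_label n_odd.
  have jarc : (j.+2 == n.+1) = false by apply/negbTE.
  rewrite jarc.
  have [jo|jo] := eqVneq j.+2 (over_label n h).
    by rewrite jo level_over // ltnW.
  have [ju|ju] := eqVneq j.+2 (under_label n h).
    by rewrite ju level_under.
  by rewrite entE // => + ij; rewrite [j == i]eq_sym (negPf ij) eqxx.
rewrite (bigD1 c) //= mxE eqxx.
have [h [_ _ -> _]] := rowE c; rewrite eqxx mul1r.
rewrite [X in _ * X]big1 ?mulr1 // => i ic.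
rewrite mxE (negPf ic); have [h' [hn il _ ->]] := rowE i.
- by rewrite eqxx.
- move: il; rewrite /over_label /under_label oddS => /orP[] /eqP ->;
    case: (boolP (odd h')) => o /=; lia.
(* When n = 1 the crossing joins the closing arc to itself; the two labels can
   agree only there. *)
have iarc : i.+2 != n.+1 := ic.
move: il iarc; rewrite /over_label /under_label oddS => /orP[] /eqP ->;
  case: (boolP (odd h')) => o /=; lia.
Qed.

End TorusAlexander.

Definition torus_alexander t : lpoly :=
  laurent t (\poly_(k < t.*2.+1) (-1) ^+ k).

Lemma lfrac_torus_alexander t :
  lfrac (torus_alexander t) = T ^ (- t%:Z) * \sum_(k < t.*2.+1) (- T) ^+ k.
Proof.
rewrite lfrac_laurent poly_def rmorph_sum; congr (_ * _).
apply: eq_bigr => k _; rewrite -mul_polyC rmorphM /= tofracC.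
by rewrite 2!rmorphXn rmorphN1 -exprMn mulN1r.
Qed.

Lemma torus_alexander_in t r : - t%:Z <= r <= t%:Z ->
  torus_alexander t r = (-1) ^+ absz (r + t%:Z).
Proof.
move=> rt; have -> : r = (absz (r + t%:Z))%:Z - t%:Z by lia.
rewrite laurentE coef_poly subrK absz_nat; case: ifP => //; lia.
Qed.

Lemma torus_alexander_out t r : ~~ (- t%:Z <= r <= t%:Z) ->
  torus_alexander t r = 0.
Proof.
move=> rt; have [lt|gt] := ltP r (- t%:Z); first by rewrite laurent_below.
have -> : r = (absz (r + t%:Z))%:Z - t%:Z by lia.
rewrite laurentE coef_poly; case: ifP => //; lia.
Qed.

Lemma torus_alexanderP t : is_alexander (torus_diagram t) (torus_alexander t).
Proof.
split.
- exists false, (- t%:Z).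
  by rewrite lfrac_torus_alexander det_alexander_torus expr0 mul1r.
- move=> r; have [rt|rt] := boolP (- t%:Z <= r <= t%:Z); last first.
    by rewrite !torus_alexander_out //; lia.
  rewrite !torus_alexander_in //; last lia.
  rewrite -signr_odd -[RHS]signr_odd; congr ((-1) ^+ _); lia.
rewrite sum_coef_laurent horner_poly.
under eq_bigr do rewrite expr1n mulr1.
elim: t => [|t IH]; first by rewrite big_ord1.
by rewrite doubleS 2!big_ord_recr /= IH [_ ^+ t.*2.+2]exprS mulN1r addrK.
Qed.

(** Any Alexander polynomial of the diagram is +-T^j times the explicit one; a
    nonzero symmetric polynomial times T^j is symmetric only if j = 0.  The sign
    disappears in the square, which is all that rho_1 depends on. *)
Lemma alexander_torus_sqr t : lfrac (alexander (torus_diagram t)) ^+ 2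
  = (T ^+ (2 * t))^-1 * (\sum_(k < t.*2.+1) (- T) ^+ k) ^+ 2.
Proof.
have [] : is_alexander (torus_diagram t) (alexander (torus_diagram t)).
  apply: classical_sets.xgetPex; exists (torus_alexander t).
  exact: torus_alexanderP.
move: (alexander _) => p [s [k ep]] sym _.
have {}ep : lfrac p = (-1) ^+ s * T ^ (k + t%:Z) * lfrac (torus_alexander t).
  rewrite ep det_alexander_torus lfrac_torus_alexander expfzDr ?T_neq0 //.
  by rewrite -!mulrA [T ^ t%:Z * _]mulrA -expfzDr ?T_neq0 // subrr mul1r.
have shift := lfrac_shift ep.
have nz r : - t%:Z <= r <= t%:Z -> torus_alexander t r != 0.
  by move=> rt; rewrite torus_alexander_in // signr_eq0.
(* The end terms T^t and T^-t of the explicit polynomial are shifted to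
   exponents whose opposites must lie in the shifted support. *)
have k0 : k + t%:Z = 0.
  have bound j : j = t%:Z \/ j = - t%:Z ->
      - t%:Z <= - j - (k + t%:Z) *+ 2 <= t%:Z.
    move=> jt; apply: contraT => out.
    have := sym (j + (k + t%:Z)); rewrite !shift addrK.
    rewrite torus_alexander_out ?mulr0; last by move: out; lia.
    move=> /esym/eqP; rewrite mulf_eq0 signr_eq0 (negPf (nz j _)) //; lia.
  have := bound _ (or_introl erefl); have := bound _ (or_intror erefl); lia.
rewrite ep k0 mulr1 exprMn sqrr_sign mul1r.
rewrite lfrac_torus_alexander exprMn; congr (_ * _).
by rewrite -invr_expz -exprnP exprVn -exprM mulnC.
Qed.

(** * The limit *)

Lemma torus_rho1 t : let n := t.*2.+1 in let q := - T in
  T ^+ (2 * t) * rho1 (torus_diagram t) * (1 - q) ^+ 2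
  = \sum_(k < n.+1) (q ^+ 2) ^+ k - (1 + (q ^+ n) ^+ 2) *+ t.+1.
Proof.
move=> n q; rewrite /rho1 alexander_torus_sqr torus_turning.
have -> : \sum_(c <- crossings (torus_diagram t)) R1 (torus_diagram t) c
  = \sum_(h < n) ((q ^+ (n - h) - q) * (q ^+ (n - h) - q ^+ h)
                   / (1 - q ^+ n) ^+ 2 - 2^-1).
  rewrite torus_crossingsE big_map -[iota 0 n]/(index_iota 0 n) big_mkord.
  by apply: eq_bigr => h _; apply: torus_R1.
have F2 : 2 != 0 :> ratfun.
  have -> : 2 = tofrac 2%:P :> ratfun by rewrite tofracC.
  by rewrite tofrac_eq0 polyC_eq0.
have n_odd : odd n by rewrite /n /= odd_double.
exact: (rho1_closed one_sub_oppT_neq0 (one_sub_oppTn_neq0 n_odd) F2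
  (expf_neq0 _ T_neq0)).
Qed.

Theorem theorem1p2 :
  exists d : nat -> lpoly,
    [/\ forall t : nat,
          lfrac (d t) =
          T ^+ (2 * t)
          * (T ^+ 2 * rho1 (torus_diagram t.+1) - rho1 (torus_diagram t)),
        stabilizes_positively d
      & exists2 c : int -> int,
          limit_series d c & laurent_expansion (- (1 / (1 + T) ^+ 2)) c].
Proof.
pose d t := laurent 0 (diff_poly t).
have coef_d t r : r < (t.*2.+1)%:Z -> d t r = expansion_coef r.
  case: r => k kt; last by rewrite /d laurent_below ?oppr0.
  rewrite -[Posz k]subr0 /d (laurentE 0) subr0.
  have := diff_polyE t; rewrite /= -exprM; move/coef_expansion; apply.
  by move: kt; lia.
exists d; split.
- move=> t; rewrite lfrac_laurent oppr0 mul1r.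
  have e0 := torus_rho1 t.
  have e1 := torus_rho1 t.+1.
  apply: (mulIf (expf_neq0 2 one_sub_oppT_neq0)).
  have := congr1 (@tofrac _) (diff_polyE t).
  have -> : T ^+ (2 * t) * (T ^+ 2 * rho1 (torus_diagram t.+1)
        - rho1 (torus_diagram t)) * (1 - - T) ^+ 2
      = T ^+ (2 * t.+1) * rho1 (torus_diagram t.+1) * (1 - - T) ^+ 2
        - T ^+ (2 * t) * rho1 (torus_diagram t) * (1 - - T) ^+ 2.
    rewrite -mulrBl; congr (_ * _); rewrite mulrBr; congr (_ - _).
    by rewrite mulrA -exprD mulnS addnC.
  rewrite e0 e1 doubleS (rho1_closed_diff (- T)) sqrrN.
  rewrite rmorphM rmorphXn rmorphD rmorph1 => e; rewrite mulrC opprK e.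
  rewrite rmorphD rmorphN1 rmorphM !rmorphXn rmorphB rmorphD rmorph_nat.
  by rewrite rmorphMn !rmorphXn.
- move=> r0; exists (absz r0) => t t0 r rr0; rewrite !coef_d //; lia.
exists expansion_coef; last exact: expansion_coefP.
by move=> r; exists (absz r) => t rt; rewrite coef_d //; lia.
Qed.
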